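(* Let $n\ge 0$ be an integer and set $$p(z)=(4z-1)^{\frac32},\quad q(z)=0,\quad r(z)=\frac{\sqrt{4z-1}}{4z^2},\quad \lambda=n(n+2).$$ Then $v=g_n$ is a solution of the singular Sturm–Liouville problem $$[p(z)v']'+[q(z)+\lambda r(z)]v=0,\qquad z\in\left(\tfrac14,+\infty\right),$$ with the conditions $$v\left(\tfrac14\right)=n+1,\qquad v(+\infty)=\begin{cases}(-1)^{\frac n2}, & n\text{ even},\\ 0, & n\text{ odd}.\end{cases}$$
   Context: For each integer $n\ge 0$ and real $z\ge\frac14$, $g_n(z)=\sum_{k=0}^{\lfloor n/2\rfloor}(-1)^k\binom{n-k}{k}z^{k-\frac n2}$. Here $v(+\infty)$ means $\lim_{z\to+\infty}v(z)$. *)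

(* Defs.v *)
From mathcomp Require Import all_boot all_order all_algebra.
From mathcomp Require Import all_classical all_reals all_analysis.

Set Implicit Arguments.
Unset Strict Implicit.
Unset Printing Implicit Defensive.

Import Order.TTheory GRing.Theory Num.Theory.
Import numFieldNormedType.Exports.

Local Open Scope ring_scope.
Local Open Scope classical_set_scope.

(* Intended for z >= 1/4; the exponent k - n/2 is a real number, a half-integer
   when n is odd. In the range of k the subtraction n - k does not truncate. *)
Definition g {R : realType} (n : nat) (z : R) : R :=
  \sum_(0 <= k < (n./2).+1)
    (-1) ^+ k * 'C(n - k, k)%:R * z `^ (k%:R - n%:R / 2).

(* Classical solution of [p v']' + (q + lambda r) v = 0 on the open half-line
   (a, +oo), continuous up to the endpoint a, so that the boundary value v a is
   tied to the behaviour of v on (a, +oo). *)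
Definition SL_solution {R : realType} (p q r : R -> R) (lambda a : R)
    (v : R -> R) : Prop :=
  {within `[a, +oo[, continuous v} /\
  forall z : R, a < z ->
    [/\ derivable v z 1,
        derivable (fun x : R => p x * v^`()%classic x) z 1 &
        (fun x : R => p x * v^`()%classic x)^`()%classic z + (q z + lambda * r z) * v z = 0].

(* Main.v *)
(* With t = z^(-1/2), g_n(z) = W_n(t), where W_n(t) = U_n(t/2) and U_n is the
   Chebyshev polynomial of the second kind. Chebyshev's equation becomes
   (4 - t^2) W_n'' - 3 t W_n' + n (n + 2) W_n = 0, which is the Sturm-Liouville
   equation in the variable z; the endpoints z = 1/4 and z = +oo correspond to
   t = 2 and t = 0. *)

Require Import Defs.
From mathcomp Require Import all_boot all_order all_algebra.
From mathcomp Require Import all_classical all_reals all_analysis.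
From mathcomp Require Import ring lra zify.

Set Implicit Arguments.
Unset Strict Implicit.
Unset Printing Implicit Defensive.

Import Order.TTheory GRing.Theory Num.Theory.
Import numFieldNormedType.Exports.

Local Open Scope ring_scope.
Local Open Scope classical_set_scope.

(* Chebyshev polynomials of the second kind, rescaled: U_n(t / 2). *)
Fixpoint cheb (R : comNzRingType) (n : nat) : {poly R} :=
  match n with
  | 0 => 1
  | n1.+1 => if n1 is n2.+1 then 'X * cheb R n1 - cheb R n2 else 'X
  end.

Lemma chebSS (R : comNzRingType) n :
  cheb R n.+2 = 'X * cheb R n.+1 - cheb R n.
Proof. by []. Qed.

(** On coefficients the three-term recurrence is Pascal's rule. Letting [k] run up to [n] avoids a
    case split on parity: the extra terms have [n - k < k], so their binomial coefficient is
    zero. *)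
Lemma cheb_sum (R : comNzRingType) n (t : R) :
  (cheb R n).[t] =
  \sum_(k < n.+1) (-1) ^+ k * 'C(n - k, k)%:R * t ^+ (n - k.*2).
Proof.
suff [] : (cheb R n).[t] =
  \sum_(k < n.+1) (-1) ^+ k * 'C(n - k, k)%:R * t ^+ (n - k.*2) /\
  (cheb R n.+1).[t] =
  \sum_(k < n.+2) (-1) ^+ k * 'C(n.+1 - k, k)%:R * t ^+ (n.+1 - k.*2) by [].
elim: n => [|n [IH0 IH1]].
  by rewrite !big_ord_recl !big_ord0 !addr0 /= !hornerE expr0 expr1.
split=> //; rewrite chebSS !hornerE IH0 IH1.
rewrite big_ord_recl [RHS]big_ord_recl double0 !subn0 !bin0 mulrDr -addrA.
congr (_ + _); first by rewrite !expr0 !mul1r -exprS.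
rewrite mulr_sumr -sumrB [RHS]big_ord_recr.
rewrite [X in _ = _ + X](_ : _ = 0) ?addr0; last first.
  by rewrite bin_small ?mulr0 ?mul0r// lift0 /=; lia.
apply: eq_bigr => k _; rewrite !lift0 doubleS !subSS /=.
rewrite (_ : (n.+1 - k = (n - k).+1)%N); last by have := ltn_ord k; lia.
rewrite binS natrD exprS.
(* If [n <= 2k], truncated subtraction makes the powers of [t] disagree, but the coefficient of the
   offending one, ['C(n - k, k.+1)], is zero. *)
have [kn|kn] := leqP (k.*2).+1 n.
  by rewrite (_ : (n - k.*2 = (n - k.*2.+1).+1)%N) ?exprS; [ring|lia].
rewrite [in LHS]bin_small ?[X in _ = _ * (X%:R + _) * _]bin_small;
  [ring|lia|lia].
Qed.

(* Both relations are needed for the induction on n to close. *)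
Lemma deriv_cheb (R : comNzRingType) n :
  (4 - 'X ^+ 2) * (cheb R n.+1)^`() =
    2 * n.+2%:R * cheb R n - n.+1%:R * 'X * cheb R n.+1 /\
  (4 - 'X ^+ 2) * (cheb R n)^`() =
    n.+2%:R * 'X * cheb R n - 2 * n.+1%:R * cheb R n.+1.
Proof.
elim: n => [|n [IH1 IH0]]; first by rewrite /= derivX derivC; split; ring.
have D2 : (cheb R n.+2)^`()%R =
    cheb R n.+1 + 'X * (cheb R n.+1)^`()%R - (cheb R n)^`().
  by rewrite chebSS derivB derivM derivX mul1r.
split; last by rewrite IH1 chebSS; ring.
transitivity ((4 - 'X ^+ 2) * cheb R n.+1
  + 'X * ((4 - 'X ^+ 2) * (cheb R n.+1)^`()) - (4 - 'X ^+ 2) * (cheb R n)^`()).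
  by rewrite D2; ring.
by rewrite IH0 IH1 chebSS; ring.
Qed.

Lemma deriv_natr (R : comNzRingType) m : deriv (m%:R : {poly R}) = 0.
Proof. by rewrite -polyC_natr derivC. Qed.

(** Differentiate the first relation of [deriv_cheb], multiply by [4 - 'X ^+ 2], and eliminate the
    derivative of the lower polynomial with the second one. The factor [4 - 'X ^+ 2] then cancels,
    being nonzero at 0. *)
Lemma cheb_ode (R : numDomainType) n :
  (4 - 'X ^+ 2) * (cheb R n)^`()^`() - 3 * 'X * (cheb R n)^`()
    + n%:R * n.+2%:R * cheb R n = 0.
Proof.
case: n => [|n]; first by rewrite /= !derivC; ring.
have [E1 E0] := deriv_cheb R n.
have E : (4 - 'X ^+ 2 : {poly R}) != 0.
  apply/eqP => /(congr1 (horner^~ 0)) /eqP.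
  by rewrite -polyC_natr !hornerE expr0n subr0 pnatr_eq0.
have /(congr1 (@deriv R)) := E1.
rewrite derivB !derivM !derivX !deriv_natr => E2.
apply: (mulfI E); rewrite mulr0.
set d := 4 - 'X ^+ 2 in E E0 E1 E2 *.
(* The two added multiples vanish by [E0] and [E1]; they are chosen so that the total is identically
   [d] times the differentiated relation [E2]. *)
transitivity (d * (d * (cheb R n.+1)^`()^`() - 3 * 'X * (cheb R n.+1)^`()
    + n.+1%:R * n.+3%:R * cheb R n.+1)
  - 2 * n.+2%:R * (d * (cheb R n)^`()
      - (n.+2%:R * 'X * cheb R n - 2 * n.+1%:R * cheb R n.+1))
  + n.+2%:R * 'X * (d * (cheb R n.+1)^`()
      - (2 * n.+2%:R * cheb R n - n.+1%:R * 'X * cheb R n.+1))).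
  by rewrite E0 E1; ring.
move/eqP: E2; rewrite -subr_eq0 => /eqP E2.
transitivity (d * 0 : {poly R}); last exact: mulr0.
by rewrite -E2 /d derivB derivXn deriv_natr; ring.
Qed.

Lemma cheb_ode_eval (R : numDomainType) n (x : R) :
  (4 - x ^+ 2) * (cheb R n)^`()^`().[x] - 3 * x * (cheb R n)^`().[x]
    + n%:R * (n%:R + 2) * (cheb R n).[x] = 0.
Proof.
rewrite -natrD addn2; have := congr1 (horner^~ x) (cheb_ode R n).
by rewrite -!polyC_natr !hornerE.
Qed.

Lemma cheb_at2 (R : comNzRingType) n : (cheb R n).[2] = n.+1%:R.
Proof.
suff [] : (cheb R n).[2] = n.+1%:R /\ (cheb R n.+1).[2] = n.+2%:R by [].
elim: n => [|n [IH0 IH1]]; first by rewrite /= !hornerE.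
by split=> //; rewrite chebSS !hornerE IH0 IH1; ring.
Qed.

Lemma cheb_at0 (R : comNzRingType) n :
  (cheb R n).[0] = if odd n then 0 else (-1) ^+ n./2.
Proof.
suff [] : (cheb R n).[0] = (if odd n then 0 else (-1) ^+ n./2) /\
  (cheb R n.+1).[0] = (if odd n.+1 then 0 else (-1) ^+ (n.+1)./2) by [].
elim: n => [|n [IH0 IH1]]; first by rewrite /= !hornerE.
split=> //; rewrite chebSS !hornerE IH0 /= negbK.
by case: (odd n); rewrite ?oppr0// exprS mulN1r.
Qed.

Lemma g_cheb (R : realType) n (z : R) : 0 < z ->
  g n z = (cheb R n).[(Num.sqrt z)^-1].
Proof.
move=> z0; rewrite cheb_sum -(big_mkord xpredT
  (fun k => (-1) ^+ k * 'C(n - k, k)%:R * (Num.sqrt z)^-1 ^+ (n - k.*2))).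
(* The tail beyond [n./2] consists of zero binomial coefficients; the rest matches the sum in [g]
   term by term. *)
rewrite (@big_cat_nat _ _ _ (n./2).+1) //=; last by lia.
rewrite [X in _ = _ + X]big_nat_cond [X in _ = _ + X]big1 ?addr0; last first.
  move=> k /andP[/andP[k1 k2] _]; rewrite bin_small ?mulr0 ?mul0r//; lia.
apply: eq_big_nat => k /andP[_ kn]; congr (_ * _).
rewrite -powR12_sqrt ?ltW// -powRN -powR_mulrn ?powR_ge0// -powRrM.
congr (_ `^ _); rewrite natrB; last lia.
by rewrite -muln2 natrM; field.
Qed.

(** In terms of t = z^(-1/2) this is t' = -t^3/2, which keeps the derivative of [g] polynomial in
    t. *)
Lemma is_derive_invsqrt (R : realType) (z : R) : 0 < z ->
  is_derive z 1 (fun x : R => (Num.sqrt x)^-1) (- (Num.sqrt z)^-1 ^+ 3 / 2).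
Proof.
move=> z0.
have s0 : Num.sqrt z != 0 by rewrite gt_eqF ?sqrtr_gt0.
apply: (is_derive_eq (is_deriveV s0 (is_derive1_sqrt z0))).
by rewrite /GRing.scale /=; field.
Qed.

Lemma is_derive_g (R : realType) n (z : R) : 0 < z ->
  is_derive z 1 (g n : R -> R)
    ((cheb R n)^`()%R.[(Num.sqrt z)^-1] * (- (Num.sqrt z)^-1 ^+ 3 / 2)).
Proof.
move=> z0; have D := is_derive1_comp (g := fun x : R => (Num.sqrt x)^-1)
  (is_derive_poly (cheb R n) (Num.sqrt z)^-1) (is_derive_invsqrt z0).
apply: near_eq_is_derive D; near=> x; rewrite /= g_cheb//.
near: x; exact: lt_nbhsr.
Unshelve. all: by end_near. Qed.

(** Applied to [4 * x - 1], this turns the coefficient p into an integer power, so that the ordinary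
    power rule applies. *)
Lemma powR_sqrt_exp3 (R : realType) (x : R) :
  0 < x -> x `^ (3 / 2) = Num.sqrt x ^+ 3.
Proof.
by move=> x0; rewrite mulrC powRrM powR12_sqrt ?ltW// powR_mulrn ?sqrtr_ge0.
Qed.

Lemma is_derive_sqrt4 (R : realType) (z : R) : 1 / 4 < z ->
  is_derive z 1 (fun x : R => Num.sqrt (4 * x - 1)) (2 / Num.sqrt (4 * z - 1)).
Proof.
move=> z0; have p0 : 0 < 4 * z - 1 by lra.
have D : is_derive z 1 (fun x : R => 4 * x - 1) 4.
  apply: (is_derive_eq (is_deriveB (is_deriveZ 4 (is_derive_id z 1))
    (is_derive_cst (1 : R) z 1))).
  by rewrite subr0 /GRing.scale /= mulr1.
have D2 := is_derive1_comp (f := Num.sqrt) (g := fun x : R => 4 * x - 1)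
  (is_derive1_sqrt p0) D.
rewrite -[X in is_derive _ _ X _]/(Num.sqrt \o (fun x : R => 4 * x - 1)).
apply: (is_derive_eq D2).
have : Num.sqrt (4 * z - 1) != 0 by rewrite gt_eqF ?sqrtr_gt0.
by move=> s0; field.
Qed.

Lemma cvgy_invsqrt (R : realType) : (Num.sqrt x)^-1 @[x --> +oo] --> (0 : R).
Proof.
apply/cvgr0Pnorm_lt => e e0; near=> x.
(* Beyond 1/e^2 the square root exceeds 1/e. *)
have xe : (e^-1) ^+ 2 < x by near: x; apply: nbhs_pinfty_gt; exact: num_real.
have x0 : 0 < x by apply: le_lt_trans xe; rewrite sqr_ge0.
rewrite ger0_norm ?invr_ge0 ?sqrtr_ge0// invf_plt ?posrE ?sqrtr_gt0//.
by rewrite -[ltLHS]gtr0_norm ?invr_gt0// -sqrtr_sqr ltr_sqrt.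
Unshelve. all: by end_near. Qed.

(** With s = sqrt(4z - 1), the flux p v' is -(1/2) s^3 t^3 W_n'(t). From s' = 2/s, t' = -t^3/2 and
    s^2 t^2 = 4 - t^2, its derivative is (s t^4 / 4) ((4 - t^2) W_n'' - 3 t W_n'), to which
    Chebyshev's equation applies. *)
Lemma is_derive_flux (R : realType) n (z : R) : 1 / 4 < z ->
  is_derive z 1
    (fun x : R => (4 * x - 1) `^ (3 / 2) * (g n : R -> R)^`()%classic x)
    (- (n%:R * (n%:R + 2) * (Num.sqrt (4 * z - 1) / (4 * z ^+ 2))) * g n z).
Proof.
move=> z14; have z0 : 0 < z by lra.
set t := fun x : R => (Num.sqrt x)^-1.
set s := fun x : R => Num.sqrt (4 * x - 1).
pose F : R -> R :=
  (- 2^-1) \*: (s ^+ 3 * ((horner (cheb R n)^`() \o t) * t ^+ 3)).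
have Dt := is_derive_invsqrt z0.
have DW := is_derive1_comp (g := t) (is_derive_poly (cheb R n)^`() (t z)) Dt.
have := is_deriveZ (- 2^-1) (is_deriveM (is_deriveX 3 (is_derive_sqrt4 z14))
   (is_deriveM DW (is_deriveX 3 Dt))).
rewrite -/F => DF.
have FE : \forall x \near z,
    F x = (4 * x - 1) `^ (3 / 2) * (g n : R -> R)^`()%classic x.
  near=> x.
  have x14 : 1 / 4 < x by near: x; exact: lt_nbhsr.
  have x0 : 0 < x by lra.
  rewrite derive1E (@derive_val _ _ _ _ _ _ _ (is_derive_g n x0)).
  rewrite powR_sqrt_exp3; last by lra.
  by rewrite /F /= /GRing.scale /= /s /t !fctE; ring.
apply: (near_eq_is_derive FE); apply: (is_derive_eq DF).
rewrite g_cheb// /= /GRing.scale /= !fctE -/(t z) -/(s z).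
have u0 : Num.sqrt z != 0 by rewrite gt_eqF ?sqrtr_gt0.
have zE : z = Num.sqrt z ^+ 2 by rewrite sqr_sqrtr ?ltW.
have s0 : s z != 0 by rewrite /s gt_eqF// sqrtr_gt0; lra.
have sE : s z ^+ 2 = 4 * Num.sqrt z ^+ 2 - 1.
  by rewrite -zE /s sqr_sqrtr//; lra.
have z2E : z ^+ 2 = Num.sqrt z ^+ 4 by rewrite {1}zE -exprM.
rewrite z2E [RHS](_ : _ = - (s z / (4 * Num.sqrt z ^+ 4)) *
  (n%:R * (n%:R + 2) * (cheb R n).[t z])); last by field.
have /eqP := cheb_ode_eval n (t z); rewrite addrC addr_eq0 => /eqP ->.
rewrite (_ : 3 * s z ^+ 2 * (2 / s z) = 6 * s z); last by field.
(* Replacing s^2 by 4z - 1 leaves s only to the first power, so both sides are s times a rational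
   function of [Num.sqrt z]. *)
rewrite (exprSr (s z)) sE.
by rewrite /t; field.
Unshelve. all: by end_near. Qed.

Theorem theorem11 (R : realType) (n : nat) :
  let p := fun z : R => (4 * z - 1) `^ (3 / 2) in
  let q := fun z : R => 0 : R in
  let r := fun z : R => Num.sqrt (4 * z - 1) / (4 * z ^+ 2) in
  let lambda : R := n%:R * (n%:R + 2) in
  let v : R -> R := g n in
  [/\ SL_solution p q r lambda (1 / 4) v,
      v (1 / 4) = n%:R + 1 &
      v z @[z --> +oo] --> (if odd n then 0 else (-1) ^+ n./2 : R)].
Proof.
move=> p q r lambda v; split; first split.
(* The endpoint 1/4 is no obstacle: [g n] is differentiable at every positive point. *)
- apply: derivable_within_continuous => z; rewrite in_itv /= andbT => z14.
  by apply: (@ex_derive _ _ _ _ _ _ _ (is_derive_g n _)); lra.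
- move=> z z14; have D := is_derive_flux n z14; split.
  + by apply: (@ex_derive _ _ _ _ _ _ _ (is_derive_g n _)); lra.
  + exact: (@ex_derive _ _ _ _ _ _ _ D).
  + by rewrite derive1E (@derive_val _ _ _ _ _ _ _ D) /q add0r mulNr addNr.
- rewrite /v g_cheb; last by lra.
  rewrite (_ : 1 / 4 = 2^-1 ^+ 2); last by field.
  by rewrite sqrtr_sqr ger0_norm ?invr_ge0// invrK cheb_at2 -natr1.
- rewrite -cheb_at0.
  have H : (cheb R n).[(Num.sqrt z)^-1] @[z --> +oo] --> (cheb R n).[0].
    apply: (@cvg_comp _ _ _ _ (horner (cheb R n)) _ _ _ (@cvgy_invsqrt R)).
    exact: continuous_horner.
  (* [g_cheb] requires [0 < z], which holds eventually at infinity. *)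
  apply: cvg_trans H; apply: near_eq_cvg; near=> z.
  rewrite /v g_cheb//; near: z; apply: nbhs_pinfty_gt; exact: num_real.
Unshelve. all: by end_near. Qed.
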